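(* Let $\mathbf C$ and $\mathbf D$ be varieties, $R$ a $\mathbf D$-coalgebra in $\mathbf C$, and $X$ a subset of the underlying set $||R||$ of $|R|$. Then $R$ has a subcoalgebra $R'$ whose underlying set contains $X$ and has cardinality at most $\max(\mathrm{card}(X),\mathrm{card}(\Omega_{\mathbf C}),\mathrm{card}(\Omega_{\mathbf D}),2)^{\lambda_{\mathbf C}-}$.
   Context: A variety $\mathbf C$ is specified by a small set $\Omega_{\mathbf C}$ of operation symbols with cardinal (possibly infinite) arities $\mathrm{ari}(\alpha)$, and a set of identities; $\lambda_{\mathbf C}$ is a fixed regular infinite cardinal strictly greater than every arity; similarly for $\mathbf D$. $\coprod_\kappa A$ denotes the $\kappa$-fold copower in $\mathbf C$. A $\mathbf D$-coalgebra $R$ in $\mathbf C$ is a $\mathbf C$-algebra $|R|$ with homomorphisms (co-operations) $\alpha^R:|R|\to\coprod_{\mathrm{ari}(\alpha)}|R|$, $\alpha\in\Omega_{\mathbf D}$, such that for every $\mathbf C$-algebra $A$ the hom-set $\mathbf C(|R|,A)$, with operations induced by precomposition with the $\alpha^R$, satisfies the identities of $\mathbf D$. A subalgebra $A$ of a $\mathbf C$-algebra $B$ is copower-pure if for all cardinals $\kappa$ the induced map $\coprod_\kappa A\to\coprod_\kappa B$ is one-to-one. A $\mathbf D$-coalgebra $R'$ is a subcoalgebra of $R$ if $|R'|$ is a copower-pure subalgebra of $|R|$ and each co-operation $\alpha^{R'}$ is the restriction of $\alpha^R$ to $|R'|$ (with $\coprod_{\mathrm{ari}(\alpha)}|R'|$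 identified with its image in $\coprod_{\mathrm{ari}(\alpha)}|R|$). For a cardinal $\kappa$ and infinite cardinal $\lambda$, $\kappa^{\lambda-}$ is the least cardinal $\mu\ge\kappa$ with $\mu^\iota=\mu$ for all $\iota<\lambda$.
   Formalization: In the definition of κ^{λ-}, the condition μ^ι = μ is required only for nonzero ι < λ, since for ι = 0 it would force μ = 1 and the bound, whose base is at least 2, would be undefined. *)

(* Defs.v *)
From Stdlib Require Import Classical FunctionalExtensionality.
Set Implicit Arguments.
Unset Strict Implicit.

Definition card_le (A B : Type) : Prop := exists f : A -> B, forall x y, f x = f y -> x = y.
Definition card_lt (A B : Type) : Prop := card_le A B /\ ~ card_le B A.
Definition card_eq (A B : Type) : Prop :=
  exists f : A -> B, (forall x y, f x = f y -> x = y) /\ (forall y, exists x, f x = y).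

Definition regular_infinite (L : Type) : Prop :=
  card_le nat L /\
  forall (I : Type) (g : L -> I), card_lt I L -> exists i, ~ card_lt {x : L | g x = i} L.

Definition arity_bound (O : Type) (ar : O -> Type) (L : Type) : Prop :=
  regular_infinite L /\ forall o : O, card_lt (ar o) L.

(* kappa^{lambda-}: M is the least cardinal >= K with M^iota = M for all
   (nonzero) iota < lambda.  The bound K is given by a list of four
   types whose cardinals' maximum is meant (M >= each of them). *)
Definition lminus_cand (K1 K2 K3 K4 : Type) (L M : Type) : Prop :=
  card_le K1 M /\ card_le K2 M /\ card_le K3 M /\ card_le K4 M /\
  forall iota : Type, inhabited iota -> card_lt iota L -> card_eq (iota -> M) M.
Definition is_lambda_minus (K1 K2 K3 K4 : Type) (L M : Type) : Prop :=
  lminus_cand K1 K2 K3 K4 L M /\ forall M', lminus_cand K1 K2 K3 K4 L M' -> card_le M M'.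

Inductive term (O : Type) (ar : O -> Type) (V : Type) : Type :=
| tvar : V -> term ar V
| tapp : forall o : O, (ar o -> term ar V) -> term ar V.
Arguments tvar {O ar V} _.
Arguments tapp {O ar V} _ _.

Record variety : Type := Variety {
  op : Type;
  ari : op -> Type;
  idt : Type;
  idvar : idt -> Type;
  id_lhs : forall e : idt, term ari (idvar e);
  id_rhs : forall e : idt, term ari (idvar e) }.
Arguments op : clear implicits.
Arguments ari : clear implicits.
Arguments idt : clear implicits.
Arguments idvar : clear implicits.

Record alg (V : variety) : Type := Alg {
  carrier :> Type;
  ops : forall o : op V, (ari V o -> carrier) -> carrier }.

Arguments ops {V} a o _ : rename.
Fixpoint eval (V : variety) (A : alg V) (X : Type) (v : X -> A) (t : term (ari V) X) : A :=
  match t with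
  | tvar x => v x
  | tapp o f => ops A o (fun i => eval v (f i))
  end.

Definition satisfies (V : variety) (A : alg V) : Prop :=
  forall (e : idt V) (v : idvar V e -> A), @eval V A _ v (id_lhs e) = @eval V A _ v (id_rhs e).

Definition is_hom (V : variety) (A B : alg V) (h : A -> B) : Prop :=
  forall o (f : ari V o -> A), h (ops A o f) = ops B o (fun i => h (f i)).

Record valg (V : variety) : Type := VAlg {
  valg_alg :> alg V;
  valg_sat : satisfies valg_alg }.

Record copower (V : variety) (A : valg V) (k : Type) : Type := Copower {
  cp :> valg V;
  cp_inj : k -> A -> cp;
  cp_inj_hom : forall i, is_hom (cp_inj i);
  cp_copair : forall B : valg V, (k -> A -> B) -> cp -> B;
  cp_copair_hom : forall (B : valg V) (f : k -> A -> B),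
      (forall i, is_hom (f i)) -> is_hom (cp_copair f);
  cp_copair_inj : forall (B : valg V) (f : k -> A -> B),
      (forall i, is_hom (f i)) -> forall i a, cp_copair f (cp_inj i a) = f i a;
  cp_copair_unique : forall (B : valg V) (f : k -> A -> B) (g : cp -> B),
      (forall i, is_hom (f i)) -> is_hom g -> (forall i a, g (cp_inj i a) = f i a) ->
      forall x, g x = cp_copair f x }.

Definition copower_map (V : variety) (A B : valg V) (h : A -> B) (k : Type)
  (P : copower A k) (Q : copower B k) : P -> Q :=
  @cp_copair V A k P Q (fun i a => @cp_inj V B k Q i (h a)).

Arguments copower_map {V A B} h {k} P Q _.

Lemma is_hom_comp (V : variety) (A B C : alg V) (g : B -> C) (f : A -> B) :
  is_hom g -> is_hom f -> is_hom (fun x => g (f x)).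
Proof. intros Hg Hf o a. rewrite Hf, Hg. reflexivity. Qed.

Record precoalg (C D : variety) : Type := PreCoalg {
  coA : valg C;
  coP : forall a : op D, copower coA (ari D a);
  coop : forall a : op D, coA -> coP a;
  coop_hom : forall a, is_hom (coop a) }.
Arguments coA {C D} p : rename.
Arguments coP {C D} p a : rename.
Arguments coop {C D} p a _ : rename.
Arguments coop_hom {C D} p a : rename.

Definition homset_carrier (C D : variety) (R : precoalg C D) (B : valg C) : Type :=
  { f : coA R -> B | is_hom f }.

Definition homset_ops (C D : variety) (R : precoalg C D) (B : valg C)
  (a : op D) (fs : ari D a -> homset_carrier R B) : homset_carrier R B :=
  exist _ (fun x => @cp_copair C (coA R) (ari D a) (coP R a) B (fun i => proj1_sig (fs i)) (coop R a x))
    (is_hom_comp (@cp_copair_hom C (coA R) (ari D a) (coP R a) B _ (fun i => proj2_sig (fs i)))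
                 (coop_hom R a)).

Definition homset (C D : variety) (R : precoalg C D) (B : valg C) : alg D :=
  @Alg D (homset_carrier R B) (homset_ops (R := R) (B := B)).

Record coalg (C D : variety) : Type := Coalg {
  copre :> precoalg C D;
  coalg_law : forall B : valg C, satisfies (homset copre B) }.

Definition subcoalg_via (C D : variety) (R' R : coalg C D) (j : coA R' -> coA R) : Prop :=
  is_hom j /\ (forall x y, j x = j y -> x = y) /\
  (forall (k : Type) (P : copower (coA R') k) (Q : copower (coA R) k),
      forall x y, copower_map j P Q x = copower_map j P Q y -> x = y) /\
  (forall (a : op D) (y : coA R'),
      coop R a (j y) = copower_map j (coP R' a) (coP R a) (coop R' a y)).

(* Main.v *)
From mathcomp Require Import ssreflect ssrfun ssrbool eqtype boolp wochoice.
Require Import Defs.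

(** The subcoalgebra is carried by a subset [A] of [R] closed under the operations, under supports
    of the terms representing the values of the co-operations, and under supports of derivations:
    terms have fewer than [L] variables, and an equality of terms that holds in a copower of [R] has
    a derivation from the multiplication table of [R] using fewer than [L] elements, so adjoining
    these for every pair of terms over [A] makes [A] copower-pure. The closure is a union of
    [L] stages of size at most [M]. Purity also transfers the identities of [D], because an identity
    can be tested at the coprojections into a copower of [A], which embeds in a copower of [R]. If
    the bound [M] does not exist, [R] itself will do. *)

Set Implicit Arguments.
Unset Strict Implicit.

(** * Cardinals and well-orders *)

Lemma sig_eq (T : Type) (P : T -> Prop) (x y : {x | P x}) :
  proj1_sig x = proj1_sig y -> x = y.
Proof. by case: x y => [x px] [y py] /= e; apply: eq_exist. Qed.

Lemma card_le_refl (A : Type) : card_le A A.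
Proof. by exists (fun x => x). Qed.

Lemma card_le_trans (A B C : Type) : card_le A B -> card_le B C -> card_le A C.
Proof.
by move=> [f fI] [g gI]; exists (fun x => g (f x)) => x y /gI /fI.
Qed.

(** An index determines its element, so choosing one index per element is injective; [r] acts as a
    partial surjection from [B] onto [A]. *)
Lemma card_le_cover (A B : Type) (r : B -> A -> Prop) :
  (forall a, exists b, r b a) ->
  (forall b a a', r b a -> r b a' -> a = a') -> card_le A B.
Proof.
move=> /choice[f fP] rI; exists f => x y e.
by apply: (rI (f x)); [apply: fP | rewrite e; apply: fP].
Qed.

Lemma card_le_incl (A B : Type) (P : A -> Prop) (f : A -> B) (Q : B -> Prop) :
  (forall x y, P x -> P y -> f x = f y -> x = y) -> (forall x, P x -> Q (f x)) ->
  card_le {x | P x} {y | Q y}.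
Proof.
move=> fI PQ; exists (fun x => exist Q (f (proj1_sig x)) (PQ _ (proj2_sig x))).
by move=> [x px] [y py] [] /(fI _ _ px py) e; apply: eq_exist.
Qed.

Lemma card_le_sub (A : Type) (P Q : A -> Prop) :
  (forall x, P x -> Q x) -> card_le {x | P x} {x | Q x}.
Proof. by move=> PQ; apply: (card_le_incl (f := fun x => x)). Qed.

Lemma card_le_sig (A : Type) (P : A -> Prop) : card_le {x | P x} A.
Proof.
by exists (@proj1_sig _ _) => -[x px] [y py] /= e; apply: eq_exist.
Qed.

Lemma card_le_image (A B : Type) (P : A -> Prop) (f : A -> B) :
  card_le {y | exists x, P x /\ y = f x} {x | P x}.
Proof.
apply: (card_le_cover (r := fun x y => proj1_sig y = f (proj1_sig x))).
  by move=> [y [x [px e]]]; exists (exist _ x px).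
by move=> [b pb] [y py] [z pz] /= e e'; apply: eq_exist; rewrite e e'.
Qed.

(** An element is coded by the code of some index [i] together with its own code inside [P i]. *)
Lemma card_le_bigcup (I T M : Type) (Q : I -> Prop) (P : I -> T -> Prop) :
  card_le (M * M) M -> card_le {i | Q i} M ->
  (forall i, Q i -> card_le {x | P i x} M) ->
  card_le {x | exists i, Q i /\ P i x} M.
Proof.
move=> MM [f fI] PM; apply: card_le_trans MM.
pose g i (q : Q i) := projT1 (cid (PM i q)).
have gI i (q : Q i) : forall x y, g i q x = g i q y -> x = y.
  exact: projT2 (cid (PM i q)).
apply: (card_le_cover (r := fun m x => exists i (q : Q i) (p : P i (proj1_sig x)),
  m = (f (exist _ i q), g i q (exist _ _ p)))).
  by move=> [x [i [q p]]]; exists (f (exist _ i q), g i q (exist _ _ p)), i, q, p.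
move=> _ [x ?] [y ?] [i [q [p ->]]] [i' [q' [p' []]]] /fI [e]; subst i'.
(* Proofs of [Q i] must be identified before the two codes inside [P i] can be compared. *)
rewrite (Prop_irrelevance q' q) => /gI [e].
exact: eq_exist.
Qed.

Lemma card_le_fun (I A M : Type) : card_le A M -> card_le (I -> A) (I -> M).
Proof.
move=> [f fI]; exists (fun g i => f (g i)) => g h e; apply: funext => i.
by apply: fI; apply: (congr1 (fun k => k i) e).
Qed.

Lemma cantor (A : Type) : ~ card_le (A -> bool) A.
Proof.
(* The diagonal set; quantifying over all [g] with code [a] replaces an inverse of [f]. *)
move=> [f fI]; pose D := fun a => `[< forall g, f g = a -> g a = false >].
have H : D (f D) = true -> False.
  by move=> e; move: (e) => /asboolP /(_ _ erefl); rewrite e.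
apply: (H); apply/asboolP => g /fI ->; by apply/negP => /H.
Qed.

Lemma well_order_exists (L : Type) : exists lt : L -> L -> Prop,
  well_founded lt /\ forall x y, lt x y \/ x = y \/ lt y x.
Proof.
have [R Rwo] := well_ordering_principle {classic L}.
have min (P : L -> Prop) : (exists x, P x) ->
    exists m, P m /\ forall x, P x -> R m x.
  move=> [x Px]; have [|m [[/asboolP Pm mP] _]] := Rwo (fun x => `[< P x >]).
    by exists x; apply/asboolP.
  by exists m; split=> // y Py; apply: mP; apply/asboolP.
exists (fun x y => ~ R y x); split.
  move=> x; apply: contrapT => nx.
  have [|m [nm mP]] := min (fun x => ~ Acc (fun x y => ~ R y x) x); first by exists x.
  by apply: nm; constructor => y ym; apply: contrapT => /mP.
move=> x y.
have [Ryx|] := pselect (R y x); last by left.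
have [Rxy|] := pselect (R x y); last by right; right.
right; left.
have Rxx z : R z z.
  have [|m [-> mP]] := min (eq z); first by exists z.
  exact: mP.
(* Two elements related both ways by [R] are both least in the pair they form, and least elements
   are unique. *)
have [|m [_ mU]] := Rwo (fun z => `[< z = x \/ z = y >]).
  by exists x; apply/asboolP; left.
have <- : m = x; last (have <- : m = y; last by []).
- apply: mU; split; first by apply/asboolP; left.
  by move=> z /asboolP [->|->].
- apply: mU; split; first by apply/asboolP; right.
  by move=> z /asboolP [->|->].
Qed.

(* Minimality of the order type: if some initial segment has the size of L, pull the order back
   along an injection into the first such segment. *)
Lemma initial_order_exists (L : Type) : exists lt : L -> L -> Prop,
  [/\ well_founded lt, forall x y, lt x y \/ x = y \/ lt y x &
      forall x, ~ card_le L {y | lt y x}].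
Proof.
have [lt [wf tri]] := well_order_exists L.
have [[l Ll]|none] := pselect (exists l, card_le L {y | lt y l}); last first.
  by exists lt; split=> // x xL; apply: none; exists x.
elim: l / (wf l) Ll => l _ IH [f fI].
have [[l' [l'l Ll']]|none] := pselect (exists l', lt l' l /\ card_le L {y | lt y l'}).
  exact: IH l'l Ll'.
exists (fun x y => lt (proj1_sig (f x)) (proj1_sig (f y))).
split.
- move=> x; have : exists z, z = proj1_sig (f x) by eexists.
  move=> [z]; elim: z / (wf z) x => z _ IHz x zx.
  by constructor => y yx; apply: (IHz (proj1_sig (f y))) => //; rewrite zx.
- move=> x y; have [?|[e|?]] := tri (proj1_sig (f x)) (proj1_sig (f y));
    [by left| |by right; right].
  right; left; apply: fI; exact: sig_eq.
- move=> x Lx; apply: none; exists (proj1_sig (f x)); split; first exact: (proj2_sig (f x)).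
  apply: card_le_trans Lx _; apply: (card_le_incl (f := fun y => proj1_sig (f y))) => //.
  move=> y z _ _ e; apply: fI; exact: sig_eq.
Qed.

Lemma card_le_or_lt (L T : Type) : card_le L T \/ card_lt T L.
Proof.
have [lt [wf tri seg]] := initial_order_exists L.
have [full|nfull] := pselect (exists l (g : {y | lt y l} -> T), forall t, exists y, g y = t).
  right; have [l [g gS]] := full.
  have Tl : card_le T {y | lt y l}.
    by apply: (card_le_cover (r := fun y t => g y = t)) => // y t t' -> .
  split; first exact: card_le_trans Tl (card_le_sig _).
  by move=> LT; apply: (seg l); apply: card_le_trans LT Tl.
left.
have ext l (g : {y | lt y l} -> T) : exists t, forall y, g y <> t.
  apply: contrapT => nt; apply: nfull; exists l, g => t.
  by apply: contrapT => nt'; apply: nt; exists t => y e; apply: nt'; exists y.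
pose step l (rec : forall y, lt y l -> T) :=
  projT1 (cid (ext l (fun y => rec (proj1_sig y) (proj2_sig y)))).
pose h := Fix wf (fun=> T) step.
have hE l : h l = step l (fun y _ => h y).
  rewrite /h Fix_eq // => x f g fg; congr step.
  by apply: functional_extensionality_dep => y; apply: funext => p.
have hne x y : lt x y -> h x <> h y.
  move=> xy; rewrite (hE y) /step; case: cid => t /= /(_ (exist _ x xy)); exact.
exists h => x y e; have [/hne|[//|/hne]] := tri x y; [exact|].
by move/(_ (esym e)).
Qed.

(** * Small subsets and closures *)

Section Small.
Context (L : Type) (Lreg : regular_infinite L).

(** By comparability this means cardinality below that of [L]; as a non-embedding it passes along
    injections directly. *)
Definition small (T : Type) (P : T -> Prop) := ~ card_le L {x | P x}.

Lemma small_sub (T : Type) (P Q : T -> Prop) :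
  (forall x, P x -> Q x) -> small Q -> small P.
Proof. by move=> PQ sQ LP; apply: sQ; apply: card_le_trans LP (card_le_sub PQ). Qed.

Lemma small_image (T U : Type) (P : T -> Prop) (f : T -> U) :
  small P -> small (fun y => exists x, P x /\ y = f x).
Proof. by move=> sP LP; apply: sP; apply: card_le_trans LP (card_le_image _ _). Qed.

Lemma bool_card_lt : card_lt bool L.
Proof.
have [[f fI] _] := Lreg; split.
  by exists (fun b : bool => f (if b then 0 else 1)) => -[] [] /fI.
move=> [g gI].
have gfI x y : g (f x) = g (f y) -> x = y by move/gI/fI.
case e0: (g (f 0)); case e1: (g (f 1)); case e2: (g (f 2));
  by [have := gfI 0 1; rewrite e0 e1 => /(_ erefl)
     |have := gfI 0 2; rewrite e0 e2 => /(_ erefl)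
     |have := gfI 1 2; rewrite e1 e2 => /(_ erefl)].
Qed.

Lemma small1 (T : Type) (x : T) : small (eq x).
Proof.
move=> Lx; apply: (proj2 bool_card_lt); apply: card_le_trans Lx _.
by exists (fun=> true) => -[y ey] [z ez] _; apply: eq_exist; rewrite -ey.
Qed.

(** If [L] embeds in the union, choosing an index for each point gives, by regularity, a fibre of
    full size, and that fibre embeds in one [P i]. *)
Lemma small_bigcup (I T : Type) (P : I -> T -> Prop) :
  card_lt I L -> (forall i, small (P i)) -> small (fun x => exists i, P i x).
Proof.
move=> IL sP [h hI].
have /choice[g gP] : forall x, exists i, P i (proj1_sig (h x)) by move=> x; case: (h x).
have [i] := proj2 Lreg I g IL; apply; split; first exact: card_le_sig.
move=> Li; apply: (sP i); apply: card_le_trans Li _.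
apply: (card_le_incl (f := fun x => proj1_sig (h x))); last by move=> x <-.
move=> x y _ _ e; apply: hI; exact: sig_eq.
Qed.

Lemma smallU (T : Type) (P Q : T -> Prop) :
  small P -> small Q -> small (fun x => P x \/ Q x).
Proof.
move=> sP sQ; apply: (@small_sub _ _ (fun x => exists b : bool, if b then P x else Q x)).
  by move=> x [px|qx]; [exists true|exists false].
by apply: small_bigcup; [exact: bool_card_lt | case].
Qed.

Lemma small0 (T : Type) : small (fun _ : T => False).
Proof. by move=> [g _]; have [[f _] _] := Lreg; case: (g (f 0)). Qed.

(** What the counting uses of $\kappa^{\lambda-}$: inequalities only, with the empty exponent
    included. *)
Definition admissible (M : Type) :=
  card_le bool M /\ forall I, card_lt I L -> card_le (I -> M) M.

Lemma lminus_cand_admissible (K1 K2 K3 M : Type) :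
  lminus_cand K1 K2 K3 bool L M -> admissible M.
Proof.
move=> [_ [_ [_ [bM Mexp]]]]; split=> // I IL.
have [i|nI] := pselect (inhabited I).
  by have [f [fI _]] := Mexp I i IL; exists f.
(* For an empty exponent there is only one function, so a constant map is injective. *)
have [b _] := bM; exists (fun=> b true) => f g _.
by apply: funext => x; case: nI.
Qed.

Section Admissible.
Context (M : Type) (adM : admissible M).

Lemma admissible_inhabited : inhabited M.
Proof. by have [[f _] _] := adM; exact: (inhabits (f true)). Qed.

Lemma admissible_prod : card_le (M * M) M.
Proof.
apply: card_le_trans (proj2 adM _ bool_card_lt).
exists (fun p (b : bool) => if b then fst p else snd p) => -[a b] [c d] /= e.
have /= -> := congr1 (fun f => f true) e.
by have /= -> := congr1 (fun f => f false) e.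
Qed.

(** Were [M] smaller than [L], it would be an allowed exponent, giving $2^M\le M^M\le M$ against
    Cantor. *)
Lemma admissible_ge : card_le L M.
Proof.
have [//|ML] := card_le_or_lt L M.
case: (@cantor M); apply: card_le_trans (proj2 adM _ ML).
exact: card_le_fun (proj1 adM).
Qed.

Lemma small_card_le (T : Type) (P : T -> Prop) : small P -> card_le {x | P x} M.
Proof.
move=> sP; have [//|[PL _]] := card_le_or_lt L {x | P x}.
exact: card_le_trans PL admissible_ge.
Qed.

Lemma admissible_bigcup (I T : Type) (Q : I -> Prop) (P : I -> T -> Prop) :
  card_le {i | Q i} M -> (forall i, Q i -> card_le {x | P i x} M) ->
  card_le {x | exists i, Q i /\ P i x} M.
Proof. exact: card_le_bigcup admissible_prod. Qed.

Lemma admissible_bigcupT (I T : Type) (P : I -> T -> Prop) :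
  card_le I M -> (forall i, card_le {x | P i x} M) ->
  card_le {x | exists i, P i x} M.
Proof.
move=> IM PM.
apply: card_le_trans (admissible_bigcup (card_le_trans (card_le_sig (fun=> True)) IM)
  (fun i _ => PM i)).
by apply: card_le_sub => x [i p]; exists i.
Qed.

Lemma admissible_setU (T : Type) (P Q : T -> Prop) :
  card_le {x | P x} M -> card_le {x | Q x} M -> card_le {x | P x \/ Q x} M.
Proof.
move=> PM QM.
apply: card_le_trans (@admissible_bigcupT bool T (fun b x => if b then P x else Q x)
  (proj1 adM) _); last by case.
by apply: card_le_sub => x [p|q]; [exists true|exists false].
Qed.

(* The stages [U l], for [l] running over an initial well-order of [L]: regularity of [L] puts any
   small part of the union inside a single stage. *)
Lemma chain_closure (T : Type) (Phi : (T -> Prop) -> T -> Prop) :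
  (forall S, card_le {x | S x} M -> card_le {x | Phi S x} M) ->
  exists A : T -> Prop, card_le {x | A x} M /\
    forall P : T -> Prop, small P -> (forall x, P x -> A x) ->
    exists S, [/\ forall x, P x -> S x, forall x, S x -> A x & forall x, Phi S x -> A x].
Proof.
move=> PhiM; have [lt [wf tri seg]] := initial_order_exists L.
pose step l (rec : forall y, lt y l -> T -> Prop) :=
  Phi (fun b => exists y, exists h : lt y l, rec y h b).
pose st := Fix wf (fun=> T -> Prop) step.
pose U l b := exists y, lt y l /\ st y b.
have stE l : st l = Phi (U l).
  rewrite /st Fix_eq; last first.
    move=> x f g fg; congr step.
    by apply: functional_extensionality_dep => y; apply: funext => p.
  congr Phi; apply: funext => b; apply: propext; split.
    by move=> [y [h s]]; exists y.
  by move=> [y [h s]]; exists y, h.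
have stM l : card_le {x | st l x} M.
  elim: l / (wf l) => l _ IH; rewrite stE; apply: PhiM.
  by apply: admissible_bigcup => //; exact: small_card_le (seg l).
exists (fun x => exists l, st l x); split.
  by apply: admissible_bigcupT => //; exact: admissible_ge.
move=> P sP PA.
have [l lP] : exists l, forall x, P x -> exists y, lt y l /\ st y x.
  have /choice[k kP] : forall x : {x | P x}, exists l, st l (proj1_sig x).
    by move=> [x px]; exact: PA.
  apply: contrapT => nl.
  (* The stages [k x] form a set of size below [L]. If no [l] exceeds them all, each [l] lies at or
     below one of them; sending [l] there has fibres inside a proper segment with one added point,
     contradicting regularity. *)
  pose I := {y | exists x, True /\ y = k x}.
  have IP : card_le I {x | P x}.
    exact: card_le_trans (card_le_image (fun=> True) k) (card_le_sig _).
  have IL : card_lt I L.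
    by split; [exact: card_le_sig | move=> LI; apply: sP; apply: card_le_trans LI IP].
  have /choice[g gP] : forall l, exists i : I, l = proj1_sig i \/ lt l (proj1_sig i).
    move=> l; apply: contrapT => ng; apply: nl; exists l => x px.
    exists (k (exist _ x px)); split; last exact: kP (exist _ x px).
    have [//|H] := tri (k (exist _ x px)) l.
    case: ng; exists (exist _ (k (exist _ x px)) (ex_intro _ _ (conj Logic.I erefl))) => /=.
    by case: H; [left|right].
  have [i] := proj2 Lreg I g IL; apply; split; first exact: card_le_sig.
  apply: (@small_sub _ _ (fun y => proj1_sig i = y \/ lt y (proj1_sig i))).
    by move=> x <-; case: (gP x); [left|right].
  apply: (@smallU _ _ (fun y => lt y (proj1_sig i))); [exact: small1 | exact: seg].
exists (U l); split=> [//| |].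
- by move=> x [y [_ s]]; exists y.
- by move=> x s; exists l; rewrite stE.
Qed.

End Admissible.
End Small.

(** * Presented algebras and copowers *)

Section Deriv.
Context (C : variety).

Definition term_alg (V : Type) : alg C := Alg (carrier := term (ari C) V) (fun o f => tapp o f).

Definition subst (V W : Type) (r : V -> term (ari C) W) (t : term (ari C) V) : term (ari C) W :=
  eval (A := term_alg W) r t.

Lemma eval_hom (A B : alg C) (h : A -> B) (V : Type) (v : V -> A) (t : term (ari C) V) :
  is_hom h -> h (eval v t) = eval (fun x => h (v x)) t.
Proof.
move=> hh; elim: t => [//|o f IH] /=; rewrite hh; congr ops.
by apply: funext => i; rewrite IH.
Qed.

Lemma eval_is_hom (A : alg C) (V : Type) (v : V -> A) :
  is_hom (A := term_alg V) (fun t => eval v t).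
Proof. by []. Qed.

Lemma eval_subst (A : alg C) (V W : Type) (r : V -> term (ari C) W) (w : W -> A) t :
  eval w (subst r t) = eval (fun x => eval w (r x)) t.
Proof. exact: (eval_hom (A := term_alg W) r t (eval_is_hom w)). Qed.

Lemma subst_tvar (V : Type) (t : term (ari C) V) : subst (fun x => tvar x) t = t.
Proof.
rewrite /subst; elim: t => [//|o f IH] /=; congr tapp; apply: funext => i; exact: IH.
Qed.

Fixpoint vars_in (V : Type) (P : V -> Prop) (t : term (ari C) V) : Prop :=
  match t with
  | tvar x => P x
  | tapp o f => forall i, vars_in P (f i)
  end.

Lemma vars_in_sub (V : Type) (P Q : V -> Prop) (t : term (ari C) V) :
  (forall x, P x -> Q x) -> vars_in P t -> vars_in Q t.
Proof. by move=> PQ; elim: t => /= [x /PQ//|o f IH H i]; exact: IH. Qed.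

Lemma vars_in_subst (V W : Type) (r : V -> term (ari C) W) (P : W -> Prop) t :
  vars_in (fun x => vars_in P (r x)) t -> vars_in P (subst r t).
Proof. by rewrite /subst; elim: t => //= o f IH H i; exact: IH. Qed.

Lemma vars_inT (V : Type) (t : term (ari C) V) (P : V -> Prop) :
  (forall x, P x) -> vars_in P t.
Proof. by move=> PT; elim: t => //=. Qed.

Lemma eval_eq_in (A : alg C) (V : Type) (P : V -> Prop) (v w : V -> A) t :
  (forall x, P x -> v x = w x) -> vars_in P t -> eval v t = eval w t.
Proof.
move=> vw; elim: t => /= [x /vw//|o f IH H]; congr ops; apply: funext => i; exact: IH.
Qed.

(** Infinitary equational logic. Being inductive rather than an intersection of congruences, it lets
    the elements used by a derivation be collected by induction. *)
Inductive deriv (V : Type) (Rl : term (ari C) V -> term (ari C) V -> Prop) :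
    term (ari C) V -> term (ari C) V -> Prop :=
| deriv_rel s t : Rl s t -> deriv Rl s t
| deriv_refl s : deriv Rl s s
| deriv_sym s t : deriv Rl s t -> deriv Rl t s
| deriv_trans s t u : deriv Rl s t -> deriv Rl t u -> deriv Rl s u
| deriv_app o f g : (forall i, deriv Rl (f i) (g i)) -> deriv Rl (tapp o f) (tapp o g)
| deriv_id e r : deriv Rl (subst r (@id_lhs C e)) (subst r (@id_rhs C e)).

Lemma deriv_mono (V : Type) (Rl Rl' : term (ari C) V -> term (ari C) V -> Prop) s t :
  (forall p q, Rl p q -> Rl' p q) -> deriv Rl s t -> deriv Rl' s t.
Proof.
move=> sub; elim.
- by move=> p q /sub; exact: deriv_rel.
- by move=> p; exact: deriv_refl.
- by move=> p q _; exact: deriv_sym.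
- by move=> p q u _ pq _; exact: deriv_trans pq.
- by move=> o f g _ IH; exact: deriv_app.
- by move=> e r; exact: deriv_id.
Qed.

Lemma deriv_sound (V : Type) (Rl : term (ari C) V -> term (ari C) V -> Prop)
    (B : valg C) (v : V -> B) s t :
  (forall p q, Rl p q -> eval v p = eval v q) -> deriv Rl s t -> eval v s = eval v t.
Proof.
move=> vR; elim=> //=.
- by move=> p q u _ -> _ ->.
- by move=> o f g _ IH; congr ops; apply: funext.
- by move=> e r; rewrite !eval_subst; exact: valg_sat.
Qed.

Section Presented.
Context (V : Type) (Rl : term (ari C) V -> term (ari C) V -> Prop).

(** Classes are kept as predicates, so that equivalent terms give equal elements by extensionality;
    operations act on chosen representatives. *)
Definition pres_carrier := {c : term (ari C) V -> Prop | exists t, c = deriv Rl t}.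

Definition cls (t : term (ari C) V) : pres_carrier :=
  exist _ (deriv Rl t) (ex_intro _ t erefl).

Lemma cls_surj (c : pres_carrier) : exists t, c = cls t.
Proof. by case: c => c [t e]; exists t; apply: sig_eq. Qed.

Definition repr (c : pres_carrier) : term (ari C) V := projT1 (cid (cls_surj c)).

Lemma reprK c : cls (repr c) = c.
Proof. by rewrite /repr; case: cid. Qed.

Lemma clsE s t : cls s = cls t <-> deriv Rl s t.
Proof.
split=> [[e]|st]; first by rewrite e; exact: deriv_refl.
apply: sig_eq => /=; apply: funext => u; apply: propext; split.
  by apply: deriv_trans; exact: deriv_sym.
exact: deriv_trans.
Qed.

Definition pres_alg : alg C :=
  Alg (carrier := pres_carrier) (fun o f => cls (tapp o (fun i => repr (f i)))).

Lemma cls_hom : is_hom (A := term_alg V) (B := pres_alg) cls.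
Proof.
move=> o f /=; apply/clsE; apply: deriv_app => i; apply/clsE; by rewrite reprK.
Qed.

Lemma pres_sat : satisfies pres_alg.
Proof.
move=> e v.
have E t : eval (A := pres_alg) v t = cls (subst (fun x => repr (v x)) t).
  rewrite /subst (eval_hom (B := pres_alg) _ _ cls_hom); congr eval.
  by apply: funext => x; rewrite reprK.
by rewrite !E; apply/clsE; exact: deriv_id.
Qed.

Definition pres : valg C := VAlg pres_sat.

Lemma eval_cls t : eval (A := pres) (fun x => cls (tvar x)) t = cls t.
Proof.
rewrite -{2}(subst_tvar t) /subst (eval_hom (B := pres_alg) _ _ cls_hom); exact: erefl.
Qed.

End Presented.

(** Soundness in the algebra presented by [Rl'], at the classes of the terms [r x], spares a second
    induction on derivations. *)
Lemma deriv_subst (V W : Type) Rl Rl' (r : V -> term (ari C) W) s t :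
  (forall p q, Rl p q -> deriv Rl' (subst r p) (subst r q)) ->
  deriv Rl s t -> deriv Rl' (subst r s) (subst r t).
Proof.
move=> RR'; have E p : eval (A := pres Rl') (fun x => cls Rl' (r x)) p = cls Rl' (subst r p).
  by rewrite /subst (eval_hom (B := pres_alg Rl') _ _ (@cls_hom _ Rl')).
move=> st; apply/clsE; rewrite -!E; apply: (@deriv_sound _ Rl (pres Rl') _ _ _ _ st) => p q /RR' pq.
by rewrite !E; apply/clsE.
Qed.

(* The multiplication-table relations of [A], repeated in each of the [K] summands and restricted
   to the part [S] of [A]: together they present the copower. *)
Inductive table (K : Type) (A : alg C) (S : A -> Prop) :
    term (ari C) (K * A) -> term (ari C) (K * A) -> Prop :=
| Table i o (f : ari C o -> A) : (forall x, S (f x)) -> S (ops A o f) ->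
    table S (tvar (i, ops A o f)) (tapp o (fun x => tvar (i, f x))).

Lemma table_sound (K : Type) (A : alg C) (S : A -> Prop) (B : alg C) (h : K -> A -> B) p q :
  (forall i, is_hom (h i)) -> table S p q ->
  eval (fun x => h (fst x) (snd x)) p = eval (fun x => h (fst x) (snd x)) q.
Proof. by move=> hh [] i o f _ _ /=; rewrite hh. Qed.

Definition ceq (K : Type) (A : alg C) (S : A -> Prop) := deriv (table (K := K) S).

Lemma ceq_mono (K : Type) (A : alg C) (S S' : A -> Prop) s t :
  (forall x, S x -> S' x) -> ceq (K := K) S s t -> ceq S' s t.
Proof.
by move=> SS'; apply: deriv_mono => _ _ [] i o f Sf So; apply: Table => [x|]; apply: SS'.
Qed.

(** * Copowers presented by multiplication tables *)

Section Copower.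
Context (A : valg C) (K : Type).
Let Rl := table (K := K) (A := A) (fun=> True).

Definition free_inj (i : K) (a : A) : pres Rl := cls Rl (tvar (i, a)).

Lemma free_inj_hom i : is_hom (free_inj i).
Proof.
move=> o f; apply: etrans (@cls_hom _ Rl o (fun x => tvar (i, f x))).
by apply/clsE/deriv_rel/Table.
Qed.

Definition free_copair (B : valg C) (f : K -> A -> B) (x : pres Rl) : B :=
  eval (fun p => f (fst p) (snd p)) (repr x).

Lemma free_copairE (B : valg C) (f : K -> A -> B) t : (forall i, is_hom (f i)) ->
  free_copair f (cls Rl t) = eval (fun p => f (fst p) (snd p)) t.
Proof.
move=> hf; apply: (@deriv_sound _ Rl) => [p q|]; first exact: table_sound.
by apply/clsE; rewrite reprK.
Qed.

Lemma free_copair_hom (B : valg C) (f : K -> A -> B) :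
  (forall i, is_hom (f i)) -> is_hom (free_copair f).
Proof.
move=> hf o g; rewrite free_copairE //=.
Qed.

Lemma free_copair_inj (B : valg C) (f : K -> A -> B) :
  (forall i, is_hom (f i)) -> forall i a, free_copair f (free_inj i a) = f i a.
Proof. by move=> hf i a; rewrite free_copairE. Qed.

Lemma free_copair_unique (B : valg C) (f : K -> A -> B) (g : pres Rl -> B) :
  (forall i, is_hom (f i)) -> is_hom g -> (forall i a, g (free_inj i a) = f i a) ->
  forall x, g x = free_copair f x.
Proof.
move=> hf hg gf x; have [t ->] := cls_surj x; rewrite free_copairE //.
rewrite -[cls Rl t]eval_cls (eval_hom (A := pres Rl) _ _ hg); congr eval.
by apply: funext => -[i a]; rewrite -gf.
Qed.

Definition free_copower : copower A K :=
  Copower free_inj_hom free_copair_hom free_copair_inj free_copair_unique.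

Definition ceval (P : copower A K) (t : term (ari C) (K * A)) : P :=
  eval (fun p => cp_inj P (fst p) (snd p)) t.

Lemma copair_ceval (P : copower A K) (B : valg C) (f : K -> A -> B) t :
  (forall i, is_hom (f i)) ->
  cp_copair f (ceval P t) = eval (fun p => f (fst p) (snd p)) t.
Proof.
move=> hf; rewrite (eval_hom _ _ (cp_copair_hom (c := P) hf)); congr eval.
by apply: funext => p; rewrite cp_copair_inj.
Qed.

Lemma copower_hom_ext (P : copower A K) (B : valg C) (g h : P -> B) :
  is_hom g -> is_hom h ->
  (forall i a, g (cp_inj P i a) = h (cp_inj P i a)) -> forall x, g x = h x.
Proof.
move=> hg hh gh x.
have hi i : is_hom (fun a => h (cp_inj P i a)).
  by apply: is_hom_comp hh _; exact: cp_inj_hom.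
by rewrite (cp_copair_unique hi hg gh) -(cp_copair_unique hi hh).
Qed.

(** The maps to and from the presented copower compose to the identity on [P], and elements of the
    presented copower are classes of terms. *)
Lemma ceval_surj (P : copower A K) (x : P) : exists t, x = ceval P t.
Proof.
pose phi := cp_copair (c := P) (B := free_copower) free_inj.
have hphi : is_hom phi := cp_copair_hom (c := P) (B := free_copower) free_inj_hom.
pose psi := cp_copair (c := free_copower) (B := P) (cp_inj P).
have hpsi : is_hom psi := cp_copair_hom (c := free_copower) (@cp_inj_hom _ _ _ P).
have -> : x = psi (phi x).
  apply: (@copower_hom_ext P P (fun x => x) (fun x => psi (phi x))) => //.
    exact: is_hom_comp hpsi hphi.
  move=> i a; rewrite /phi cp_copair_inj; last exact: free_inj_hom.
  by apply/esym/(@free_copair_inj P); exact: cp_inj_hom.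
have [t ->] := cls_surj (phi x); exists t.
by rewrite /psi /= free_copairE //; exact: cp_inj_hom.
Qed.

(** The copairing into the presented copower turns an equality in [P] into a derivation; soundness
    gives the converse. *)
Lemma ceval_eq (P : copower A K) s t :
  ceval P s = ceval P t <-> ceq (K := K) (A := A) (fun=> True) s t.
Proof.
split=> [e|]; last first.
  by apply: deriv_sound => p q; apply: table_sound; exact: cp_inj_hom.
apply/clsE; have := congr1 (cp_copair (c := P) (B := free_copower) free_inj) e.
rewrite !copair_ceval; try exact: free_inj_hom.
have E u : eval (fun p => free_inj p.1 p.2) u = cls Rl u.
  by rewrite -eval_cls; congr eval; apply: funext => -[].
by rewrite !E.
Qed.

End Copower.

Lemma copower_map_hom (A B : valg C) (j : A -> B) (K : Type)
  (P : copower A K) (Q : copower B K) : is_hom j -> is_hom (copower_map j P Q).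
Proof.
move=> hj; apply: cp_copair_hom => i; apply: (is_hom_comp (g := cp_inj Q i)) hj; exact: cp_inj_hom.
Qed.

Lemma copower_map_inj (A B : valg C) (j : A -> B) (K : Type)
  (P : copower A K) (Q : copower B K) i a : is_hom j ->
  copower_map j P Q (cp_inj P i a) = cp_inj Q i (j a).
Proof.
move=> hj; apply: cp_copair_inj => k; apply: (is_hom_comp (g := cp_inj Q k)) hj; exact: cp_inj_hom.
Qed.

Definition rename (V W : Type) (f : V -> W) : term (ari C) V -> term (ari C) W :=
  subst (fun x => tvar (f x)).

Lemma subst_rename (U V W : Type) (f : U -> V) (r : V -> term (ari C) W) t :
  subst r (rename f t) = subst (fun x => r (f x)) t.
Proof. exact: (eval_subst (A := term_alg W)). Qed.

Lemma copower_map_ceval (A B : valg C) (j : A -> B) (K : Type)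
  (P : copower A K) (Q : copower B K) t : is_hom j ->
  copower_map j P Q (ceval P t) = ceval Q (rename (fun p => (fst p, j (snd p))) t).
Proof.
move=> hj; rewrite /ceval eval_subst (eval_hom _ _ (@copower_map_hom A B j K P Q hj)); congr eval.
by apply: funext => -[i a] /=; rewrite copower_map_inj.
Qed.

(** Copower-purity in syntactic form, free of any choice of copowers. *)
Definition pure (A B : valg C) (j : A -> B) := forall K (s t : term (ari C) (K * A)),
  ceq (K := K) (A := B) (fun=> True) (rename (fun p => (fst p, j (snd p))) s)
    (rename (fun p => (fst p, j (snd p))) t) ->
  ceq (K := K) (A := A) (fun=> True) s t.

Lemma pure_copower_map (A B : valg C) (j : A -> B) (K : Type)
    (P : copower A K) (Q : copower B K) : is_hom j -> pure j ->
  forall x y, copower_map j P Q x = copower_map j P Q y -> x = y.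
Proof.
move=> hj pj x y; have [s ->] := ceval_surj x; have [t ->] := ceval_surj y.
by rewrite !copower_map_ceval // => /ceval_eq /pj /ceval_eq.
Qed.

End Deriv.

(** * Locality and purity *)

Section Local.
Context (C : variety) (L : Type) (Lreg : regular_infinite L)
  (ariL : forall o : op C, card_lt (ari C o) L).

Lemma vars_small (V : Type) (t : term (ari C) V) :
  exists P : V -> Prop, small L P /\ vars_in P t.
Proof.
elim: t => [x|o f IH] /=; first by exists (eq x); split=> //; exact: small1.
have [P HP] := choice IH.
exists (fun x => exists i, P i x); split.
  by apply: small_bigcup => // i; case: (HP i).
by move=> i; apply: vars_in_sub (proj2 (HP i)) => x Px; exists i.
Qed.

(** Each rule has fewer than [L] premises and each table entry names fewer than [L] elements, so
    regularity keeps the collected support small. *)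
Lemma ceq_small (K : Type) (A : alg C) (s t : term (ari C) (K * A)) :
  ceq (fun=> True) s t -> exists S : A -> Prop, small L S /\ ceq S s t.
Proof.
elim=> {s t}.
- move=> _ _ [] i o f _ _.
  exists (fun a => (exists x, f x = a) \/ ops A o f = a); split.
    apply: smallU => //; last exact: small1.
    by apply: small_bigcup => // x; exact: small1.
  by apply: deriv_rel; apply: Table => [x|]; [left; exists x | right].
- move=> s; exists (fun=> False); split; first exact: small0.
  exact: deriv_refl.
- by move=> s t _ [S [sS st]]; exists S; split=> //; exact: deriv_sym.
- move=> s t u _ [S [sS st]] _ [S' [sS' tu]].
  exists (fun x => S x \/ S' x); split; first exact: smallU.
  by apply: deriv_trans (ceq_mono _ st) (ceq_mono _ tu) => x; [left|right].
- move=> o f g _ IH; have [S HS] := choice IH.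
  exists (fun x => exists i, S i x); split.
    by apply: small_bigcup => // i; case: (HS i).
  by apply: deriv_app => i; apply: ceq_mono (proj2 (HS i)) => x Sx; exists i.
- move=> e r; exists (fun=> False); split; first exact: small0.
  exact: deriv_id.
Qed.

Context (M : Type) (adM : admissible L M) (opM : card_le (op C) M).

(** For each of the at most [M] symbols, argument tuples are functions on an arity below [L], so at
    most [M] in number. *)
Lemma card_le_app (A : Type) (app : forall o, (ari C o -> A) -> A) (S : A -> Prop) :
  card_le {x | S x} M ->
  card_le {x | exists o (f : ari C o -> A), (forall i, S (f i)) /\ x = app o f} M.
Proof.
move=> SM; apply: (admissible_bigcupT Lreg adM) => // o.
have H : card_le {x | exists g : ari C o -> {x | S x}, app o (fun i => proj1_sig (g i)) = x} M.
  apply: (admissible_bigcupT Lreg adM) => [|g].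
    by apply: card_le_trans (proj2 adM _ (ariL o)); exact: card_le_fun.
  apply: (small_card_le adM); exact: small1.
apply: card_le_trans H; apply: card_le_sub => x [f [Sf ->]].
by exists (fun i => exist _ (f i) (Sf i)).
Qed.

(** A chain closure under variables and application has size at most [M] and, by induction on terms,
    contains every term over [P]. *)
Lemma term_card (V : Type) (P : V -> Prop) :
  card_le {x | P x} M -> card_le {t : term (ari C) V | vars_in P t} M.
Proof.
move=> PM.
have [|A [AM Acl]] := chain_closure Lreg adM (Phi := fun S (t : term (ari C) V) =>
  (exists x, P x /\ t = tvar x) \/ exists o f, (forall i, S (f i)) /\ t = tapp o f).
  move=> S SM; apply: (admissible_setU Lreg adM); last exact: card_le_app.
  exact: card_le_trans (card_le_image _ _) PM.
apply: card_le_trans AM; apply: card_le_sub.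
elim=> [x Px|o f IH fP].
  have [||S [_ _ SA]] := Acl (fun=> False) => //; first exact: small0.
  by apply: SA; left; exists x.
have [||S [fS _ SA]] := Acl (fun t => exists i, f i = t).
- by apply: small_bigcup => // i; exact: small1.
- by move=> _ [i <-]; apply: IH; exact: fP.
by apply: SA; right; exists o, f; split=> // i; apply: fS; exists i.
Qed.

(** One chain closure handles all conditions at once; [N] will be the supports of the values of
    co-operations. Derivations are localized for [M] summands only, so that the terms to be treated
    number at most [M]. *)
Lemma closed_subset (B : alg C) (J : Type) (X : B -> Prop) (N : J -> B -> B -> Prop) :
  card_le {x | X x} M -> card_le J M -> (forall a y, small L (N a y)) ->
  exists A : B -> Prop,
    [/\ card_le {x | A x} M, forall x, X x -> A x,
        forall o f, (forall i, A (f i)) -> A (ops B o f),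
        forall a y, A y -> forall x, N a y x -> A x &
        forall s t : term (ari C) (M * B),
          vars_in (fun p => A (snd p)) s -> vars_in (fun p => A (snd p)) t ->
          ceq (fun=> True) s t -> ceq A s t].
Proof.
move=> XM JM Nsmall.
(* [D] gives each derivable pair a small set supporting a derivation, and may be empty on the other
   pairs. *)
have /choice[D DP] : forall st : term (ari C) (M * B) * term (ari C) (M * B),
    exists S : B -> Prop, small L S /\
    (ceq (fun=> True) (fst st) (snd st) -> ceq S (fst st) (snd st)).
  move=> [s t] /=; have [/ceq_small [S [sS st]]|nst] := pselect (ceq (fun=> True) s t).
    by exists S.
  by exists (fun=> False); split=> //; exact: small0.
have [|A [AM Acl]] := chain_closure Lreg adM (Phi := fun S (x : B) =>
  (X x \/ exists o f, (forall i, S (f i)) /\ x = ops B o f) \/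
  (exists a y, S y /\ N a y x) \/
  exists s, vars_in (fun p => S (snd p)) s /\
    exists t, vars_in (fun p => S (snd p)) t /\ D (s, t) x).
  move=> S SM.
  have TM : card_le {s : term (ari C) (M * B) | vars_in (fun p => S (snd p)) s} M.
    apply: term_card.
    have H : card_le {p : M * B | exists b, S b /\ exists m, (m, b) = p} M.
      apply: (admissible_bigcup Lreg adM) => // b _.
      apply: (admissible_bigcupT Lreg adM) => [|m]; first exact: card_le_refl.
      apply: (small_card_le adM); exact: small1.
    by apply: card_le_trans H; apply: card_le_sub => -[m b] /= Sb; exists b; split=> //; exists m.
  do !apply: (admissible_setU Lreg adM) => //.
  - exact: card_le_app.
  - apply: (admissible_bigcupT Lreg adM) => // a.
    apply: (admissible_bigcup Lreg adM) => // y _; exact: (small_card_le adM).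
  - apply: (admissible_bigcup Lreg adM) => // s _.
    apply: (admissible_bigcup Lreg adM) => // t _.
    apply: (small_card_le adM); exact: (proj1 (DP (s, t))).
exists A; split=> //.
- move=> x Xx; have [||S [_ _ SA]] := Acl (fun=> False) => //; first exact: small0.
  by apply: SA; left; left.
- move=> o f fA; have [||S [fS _ SA]] := Acl (fun x => exists i, f i = x).
  + by apply: small_bigcup => // i; exact: small1.
  + by move=> _ [i <-].
  by apply: SA; left; right; exists o, f; split=> // i; apply: fS; exists i.
- move=> a y Ay x Nx; have [||S [yS _ SA]] := Acl (eq y).
  + exact: small1.
  + by move=> _ <-.
  by apply: SA; right; left; exists a, y; split=> //; apply: yS.
- move=> s t sA tA st.
  have [P [Psmall Ps]] := vars_small s; have [Q [Qsmall Qt]] := vars_small t.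
  (* Only a small set of elements of [A] occurs in the two terms, so one stage [S] contains them and
     the closure step from [S] adds [D (s, t)]. *)
  have [||S [PS SsA SA]] := Acl (fun b => exists p, ((P p \/ Q p) /\ A (snd p)) /\ b = snd p).
  + apply: small_image; apply: small_sub (smallU Lreg Psmall Qsmall) => x [//].
  + by move=> b [p [[_ Ap] ->]].
  have lift u (R : M * B -> Prop) : (forall p, R p -> P p \/ Q p) -> vars_in R u ->
      vars_in (fun p => A (snd p)) u -> vars_in (fun p => S (snd p)) u.
    move=> RPQ; elim: u => /= [p Rp Ap|o f IH Rf Af i]; last by apply: IH.
    by apply: PS; exists p; split=> //; split=> //; exact: RPQ.
  apply: ceq_mono (proj2 (DP (s, t)) st) => x Dx; apply: SA; right; right.
  exists s; split; first by apply: lift Ps sA => p; left.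
  by exists t; split=> //; apply: lift Qt tA => p; right.
Qed.

End Local.

(** * Subalgebras and their purity *)

Section Subalgebra.
Context (C : variety) (B : valg C) (A : B -> Prop)
  (clA : forall o (f : ari C o -> B), (forall i, A (f i)) -> A (ops B o f)).

Definition sub_alg : alg C := Alg (carrier := {x | A x})
  (fun o f => exist _ (ops B o (fun i => proj1_sig (f i))) (clA (fun i => proj2_sig (f i)))).

Definition sub_val (x : sub_alg) : B := proj1_sig x.

Lemma sub_val_hom : is_hom sub_val.
Proof. by []. Qed.

Lemma sub_sat : satisfies sub_alg.
Proof.
move=> e v; apply: sig_eq.
have E t : sub_val (eval (A := sub_alg) v t) = eval (fun x => sub_val (v x)) t.
  exact: eval_hom sub_val_hom.
by apply: etrans (E _) (etrans _ (esym (E _))); exact: valg_sat.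
Qed.

Definition sub_valg : valg C := VAlg sub_sat.

(* Renaming the few summands that occur in [s] and [t] injectively into [M] reduces purity to [M]
   summands; to come back, [s] itself serves as a default value outside [A]. *)
Lemma sub_val_pure (L M : Type) :
  regular_infinite L -> (forall o : op C, card_lt (ari C o) L) -> admissible L M ->
  (forall s t : term (ari C) (M * B),
     vars_in (fun p => A (snd p)) s -> vars_in (fun p => A (snd p)) t ->
     ceq (fun=> True) s t -> ceq A s t) ->
  pure (A := sub_valg) (B := B) sub_val.
Proof.
move=> Lreg ariL adM pureM K s t st.
have [[k0]|nK] := pselect (inhabited K); last first.
  (* Without summands there are no variables, so any substitution fixes [s] and [t], and the table
     relations are vacuous. *)
  have V0 : K * B -> term (ari C) (K * sub_valg) by case=> k _; case: nK.
  have sK (u : term (ari C) (K * sub_valg)) :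
      subst V0 (rename (fun p => (fst p, sub_val (snd p))) u) = u.
    rewrite subst_rename -[RHS]subst_tvar; congr subst.
    by apply: funext => -[k]; case: nK.
  rewrite -[s]sK -[t]sK; apply: deriv_subst st => _ _ [] k; by case: nK.
have [Ps [Pssmall Ps_s]] := vars_small Lreg ariL s.
have [Pt [Ptsmall Pt_t]] := vars_small Lreg ariL t.
pose Q k := exists p, (Ps p \/ Pt p) /\ k = fst p.
have [h hI] : card_le {k | Q k} M.
  by apply: (small_card_le adM); apply: small_image; exact: smallU.
have [m0] := admissible_inhabited adM.
(* Renaming summands preserves derivations, so those outside the support [Q] of [s] and [t] may all
   go to [m0]. *)
pose r k := if pselect (Q k) is left q then h (exist _ k q) else m0.
have rI k k' : Q k -> Q k' -> r k = r k' -> k = k'.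
  rewrite /r; case: pselect => // q _; case: pselect => // q' _ /hI; by case.
have /choice[r' r'P] : forall m, exists k, forall k', Q k' -> r k' = m -> k = k'.
  move=> m; have [[k [Qk <-]]|nk] := pselect (exists k, Q k /\ r k = m).
    by exists k => k' Qk' /esym; exact: rI.
  by exists k0 => k' Qk' e; case: nk; exists k'.
pose up (p : K * sub_valg) := (r (fst p), sub_val (snd p)).
have stM : ceq (K := M) (A := B) (fun=> True) (rename up s) (rename up t).
  have E u : rename up u =
      rename (fun p => (r (fst p), snd p)) (rename (fun p => (fst p, sub_val (snd p))) u).
    by rewrite {2}/rename subst_rename.
  rewrite !E; apply: deriv_subst st => _ _ [] k o f _ _.
  by apply: deriv_rel; exact: Table.
have upA (u : term (ari C) (K * sub_valg)) : vars_in (fun p => A (snd p)) (rename up u).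
  by apply: vars_in_subst; apply: vars_inT => -[k [b Ab]].
pose down (p : M * B) : term (ari C) (K * sub_valg) :=
  if pselect (A (snd p)) is left a then tvar (r' (fst p), exist _ (snd p) a) else s.
have downA m b (a : A b) : down (m, b) = tvar (r' m, exist _ b a).
  rewrite /down /=; case: pselect => // a'; congr (tvar (_, _)); exact: sig_eq.
have downK u P : vars_in P u -> (forall p, P p -> Ps p \/ Pt p) -> subst down (rename up u) = u.
  move=> Pu PQ; rewrite subst_rename -[RHS]subst_tvar.
  apply: (eval_eq_in (A := term_alg C _)) Pu => -[k [b Ab]] Pp.
  rewrite /up /= /sub_val /= downA; congr (tvar (_, _)).
  by apply: r'P => //; exists (k, exist _ b Ab); split=> //; exact: PQ.
rewrite -(downK s Ps) //; last by left.
rewrite -(downK t Pt) //; last by right.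
(* Intermediate terms may involve elements outside [A], where [down] takes its default, but the
   table relations to be translated live inside [A]. *)
apply: deriv_subst (pureM _ _ (upA s) (upA t) stM) => _ _ [] m o f fA oA.
rewrite /subst /= downA.
have -> : (fun i => down (m, f i)) = (fun i => tvar (r' m, exist _ (f i) (fA i) : sub_valg)).
  by apply: funext => i; rewrite downA.
have -> : exist A (ops B o f) oA = ops sub_alg o (fun i => exist _ (f i) (fA i)) by exact: sig_eq.
by apply: deriv_rel; exact: Table.
Qed.

End Subalgebra.

(** * Subcoalgebras *)

Section Coalgebra.
Context (C D : variety).

Definition push (R : precoalg C D) (A B : valg C) (g : A -> B) (hg : is_hom g)
  (f : homset R A) : homset R B :=
  exist _ (fun x => g (proj1_sig f x)) (is_hom_comp hg (proj2_sig f)).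

Lemma push_hom (R : precoalg C D) (A B : valg C) (g : A -> B) (hg : is_hom g) :
  is_hom (push (R := R) hg).
Proof.
move=> a fs; apply: sig_eq; apply: funext => x /=.
apply: (cp_copair_unique (g := fun z => g (cp_copair _ z))).
- by move=> i; apply: is_hom_comp hg _; exact: proj2_sig.
- by apply: is_hom_comp hg _; apply: cp_copair_hom => i; exact: proj2_sig.
- by move=> i y; rewrite cp_copair_inj // => k; exact: proj2_sig.
Qed.

(** * Transfer of identities along a pure map *)

Section Pull.
Context (R0 R : precoalg C D) (j : coA R0 -> coA R) (hj : is_hom j)
  (jcoop : forall a y, coop R a (j y) = copower_map j (coP R0 a) (coP R a) (coop R0 a y)).

Definition pull (B : valg C) (f : homset R B) : homset R0 B :=
  exist _ (fun x => proj1_sig f (j x)) (is_hom_comp (proj2_sig f) hj).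

(** Compatibility of [j] with the co-operations makes the two sides maps out of one copower that
    agree on the coprojections. *)
Lemma pull_hom (B : valg C) : is_hom (pull (B := B)).
Proof.
move=> a fs; apply: sig_eq; apply: funext => x /=; rewrite jcoop.
have hfs i : is_hom (proj1_sig (fs i)) by exact: proj2_sig.
apply: (cp_copair_unique (g := fun z => cp_copair _ (copower_map j _ _ z))).
- by move=> i; exact: is_hom_comp hj.
- by apply: is_hom_comp; [exact: cp_copair_hom | exact: copower_map_hom].
- by move=> i y; rewrite copower_map_inj // cp_copair_inj.
Qed.

(* It is enough to check an identity at the universal assignment of its variables, the coprojections
   into a copower of [R0]; purity embeds this copower in a copower of [R], where the identity holds. *)
Lemma pure_coalg_law : pure j ->
  (forall B : valg C, satisfies (homset R B)) -> forall B : valg C, satisfies (homset R0 B).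
Proof.
move=> pj law B e v.
pose P := free_copower (coA R0) (idvar D e); pose Q := free_copower (coA R) (idvar D e).
pose injP i : homset R0 P := exist _ (cp_inj P i) (@cp_inj_hom _ _ _ P i).
pose injQ i : homset R Q := exist _ (cp_inj Q i) (@cp_inj_hom _ _ _ Q i).
have hm := @copower_map_hom _ _ _ _ _ P Q hj.
have E t : push hm (eval injP t) = pull (eval injQ t).
  rewrite (eval_hom _ _ (push_hom hm)) (eval_hom _ _ (@pull_hom Q)); congr eval.
  apply: funext => i; apply: sig_eq; apply: funext => x /=; exact: (copower_map_inj P Q).
have eP : eval injP (id_lhs e) = eval injP (id_rhs e).
  apply: sig_eq; apply: funext => x; apply: (@pure_copower_map _ _ _ _ _ P Q hj pj).
  have : push hm (eval injP (id_lhs e)) = push hm (eval injP (id_rhs e)) by rewrite !E law.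
  by move/(congr1 (fun f => proj1_sig f x)).
(* The copairing of [v] sends the universal assignment [injP] to [v]. *)
have hv := cp_copair_hom (c := P) (fun i => proj2_sig (v i)).
have Ev t : eval v t = push hv (eval injP t).
  rewrite (eval_hom _ _ (push_hom hv)); congr eval.
  apply: funext => i; apply: sig_eq; apply: funext => x.
  exact: esym (@cp_copair_inj _ _ _ P B _ (fun k => proj2_sig (v k)) i x).
by rewrite !Ev eP.
Qed.

End Pull.

(** Injectivity of the copower maps determines the co-operations on [A] and forces them to be
    homomorphisms. The last two clauses keep what is needed once the carrier is hidden by the
    existential. *)
Lemma subcoalg_of_pure (R : coalg C D) (A : valg C) (j : A -> coA R) :
  is_hom j -> (forall x y, j x = j y -> x = y) -> pure j ->
  (forall a y, exists x,
     coop R a (j y) = copower_map j (free_copower A (ari D a)) (coP R a) x) ->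
  exists (R' : coalg C D) (j' : coA R' -> coA R), subcoalg_via j' /\
    (forall x, (exists y, j y = x) -> exists y, j' y = x) /\ card_le (coA R') A.
Proof.
move=> hj jI pj coopj.
pose P a := free_copower A (ari D a).
pose z a y := projT1 (cid (coopj a y)).
have zP a y : coop R a (j y) = copower_map j (P a) (coP R a) (z a y).
  exact: projT2 (cid (coopj a y)).
have zhom a : is_hom (z a).
  move=> o f; apply: (@pure_copower_map _ _ _ _ _ (P a) (coP R a) hj pj).
  rewrite -zP hj (coop_hom R a) (@copower_map_hom _ _ _ _ _ (P a) (coP R a) hj).
  by congr ops; apply: funext => i; rewrite zP.
pose R0 := PreCoalg (D := D) (coP := P) zhom.
have law := pure_coalg_law (R0 := R0) hj zP pj (@coalg_law _ _ R).
exists (Coalg law), j; split; last by split=> //; exact: card_le_refl.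
split=> //; split=> //; split=> // k P' Q'; exact: pure_copower_map.
Qed.

Lemma copower_map_id (A : valg C) (K : Type) (P : copower A K) x :
  copower_map (fun a => a) P P x = x.
Proof.
apply: (@copower_hom_ext _ _ _ P P (copower_map (fun a => a) P P) (fun x => x)) => //.
  exact: copower_map_hom.
by move=> i a; rewrite copower_map_inj.
Qed.

Lemma pure_id (A : valg C) : pure (fun a : A => a).
Proof.
move=> K s t; have E u : rename (fun p : K * A => (fst p, snd p)) u = u.
  by rewrite -[RHS]subst_tvar; congr subst; apply: funext => -[].
by rewrite !E.
Qed.

Lemma subcoalg_refl (R : coalg C D) : subcoalg_via (R' := R) (R := R) (fun a => a).
Proof.
split=> //; split=> //; split; last by move=> a y; rewrite copower_map_id.
by move=> k P Q; apply: pure_copower_map => //; exact: pure_id.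
Qed.

(** The image of the copower map contains the coprojections of the image of [j] and is closed under
    operations. *)
Lemma copower_map_im (A B : valg C) (j : A -> B) (K : Type) (P : copower A K) (Q : copower B K) t :
  is_hom j -> vars_in (fun p => exists a, j a = snd p) t ->
  exists x, ceval Q t = copower_map j P Q x.
Proof.
move=> hj; rewrite /ceval; elim: t => /= [[k b] /= [a <-]|o f IH fP].
  by exists (cp_inj P k a); rewrite copower_map_inj.
have /choice[g gP] := fun i => IH i (fP i).
exists (ops P o g); rewrite copower_map_hom //; congr ops; exact: funext.
Qed.

End Coalgebra.

Theorem theorem3p8 (C D : variety) (LC LD : Type)
  (HLC : arity_bound (ari C) LC) (HLD : arity_bound (ari D) LD)
  (R : coalg C D) (X : coA R -> Prop) :
  exists (R' : coalg C D) (j : coA R' -> coA R),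
    subcoalg_via j /\
    (forall x, X x -> exists y, j y = x) /\
    forall M : Type,
      is_lambda_minus {x : coA R | X x} (op C) (op D) bool LC M ->
      card_le (coA R') M.
Proof.
(* [R'] must be found before [M] is given; when no such [M] exists the size bound is vacuous. *)
have [[M [candM minM]]|noM] :=
  pselect (exists M : Type, is_lambda_minus {x | X x} (op C) (op D) bool LC M); last first.
  exists R, (fun a => a); split; first exact: subcoalg_refl.
  split=> [x _|M HM]; first by exists x.
  by case: noM; exists M.
have [Lreg ariL] := HLC; have adM := lminus_cand_admissible candM.
have [XM [CM [DM _]]] := candM.
(* [N (a, y)] is a small set supporting one term for the value of the co-operation [a] at [y]. *)
have /choice[N NP] : forall p : op D * coA R, exists N : coA R -> Prop, small LC N /\
    exists t, coop R (fst p) (snd p) = ceval (coP R (fst p)) t /\ vars_in (fun q => N (snd q)) t.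
  move=> [a y] /=; have [t ->] := ceval_surj (coop R a y).
  have [V [Vsmall Vt]] := vars_small Lreg ariL t.
  exists (fun b => exists q, V q /\ b = snd q); split; first exact: small_image.
  by exists t; split=> //; apply: vars_in_sub Vt => q Vq; exists q.
have [//|A [AM XA clA NA pureA]] :=
  closed_subset Lreg ariL adM CM (N := fun a y => N (a, y)) XM DM.
  by move=> a y; exact: proj1 (NP (a, y)).
have pA := sub_val_pure (clA := clA) Lreg ariL adM pureA.
have [||||R' [j [subj [jS jcard]]]] :=
  @subcoalg_of_pure C D R (sub_valg clA) (@sub_val _ _ _ clA).
- exact: sub_val_hom.
- exact: sig_eq.
- exact: pA.
(* The support of the value lies in [A], so the value comes from the copower of [A]. *)
- move=> a y; have [_ [t [-> tN]]] := NP (a, sub_val y).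
  apply: copower_map_im; first exact: sub_val_hom.
  apply: vars_in_sub tN => q /= Nq.
  have Aq : A (snd q) by apply: NA Nq; exact: (proj2_sig y).
  by exists (exist _ _ Aq).
exists R', j; split=> //; split.
  by move=> x /XA Ax; apply: jS; exists (exist _ _ Ax).
(* Any other [M'] is itself a candidate, so minimality of [M] carries the bound over to it. *)
move=> M' [candM' minM'].
exact: card_le_trans jcard (card_le_trans AM (minM _ candM')).
Qed.
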